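(* Let the collision term be $\mathcal C(f)=-\phi_0f+\phi_0\frac12\int_{-1}^1f\,d\mu+3\mu\phi_1\frac12\int_{-1}^1f\mu\,d\mu$, with $\tilde\chi\ne0$, $\tilde\chi+\phi_0\ne0$ and $\tilde\chi+\phi_0-\phi_1\neq0$. Assume Enskog's postulate and the strong Chapman--Enskog hypothesis $$\frac12\int_{-1}^1f_0\,d\mu=\beta,\qquad\frac12\int_{-1}^1f_i\,d\mu=0,\quad i=1,2,\dots$$ for the Chapman--Enskog expansion $f=\sum_{i\ge0}\varepsilon^if_i$ with $\beta=\frac12\int_{-1}^1f\,d\mu$. Then the reaction-type equation $$\frac{d\beta}{c\,dt}+\frac13\frac{d\ln\rho}{c\,dt}\,\omega\frac{\partial\beta}{\partial\omega}=j-\tilde\chi\beta$$ is an approximation of the angular mean of Boltzmann's equation $\mathcal D(f)=\varepsilon^{-1}\big(\bar j+\bar{\mathcal J}(f)\big)$ of order $\mathcal O(\varepsilon)$.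
   Context: Variables: time $t$, radius $r>0$, cosine of the propagation angle $\mu\in[-1,1]$, energy $\omega>0$; $f=f(t,r,\mu,\omega)$. The constant $c>0$ is the speed of light; $\rho=\rho(t,r)>0$ and $v=v(t,r)$ are given functions (density and radial velocity of the background matter), and $\frac{d}{dt}:=\frac{\partial}{\partial t}+v\frac{\partial}{\partial r}$. The linear operator $\mathcal D$ is $$\mathcal D(f)=\frac1c\frac{df}{dt}+\mu\frac{\partial f}{\partial r}+F_\mu\frac{\partial f}{\partial\mu}+F_\omega\frac{\partial f}{\partial\omega},$$ $$F_\mu=\frac1r(1-\mu^2)+\mu\Big(\frac{d\ln\rho}{c\,dt}+\frac{3v}{cr}\Big)(1-\mu^2),\qquad F_\omega=\Big[\mu^2\Big(\frac{d\ln\rho}{c\,dt}+\frac{3v}{cr}\Big)-\frac{v}{cr}\Big]\omega .$$ The functions $j\ge0$ (emissivity), $\chi\geq 0$ (absorptivity), $\tilde\chi=j+\chi$, $\phi_0,\phi_1$ depend on $(t,r,\omega)$ but not on $\mu$. Put $\mathcal J(f)=-\tilde\chi f+\mathcal C(f)$. Here $\varepsilon>0$ is a small parameter, $\bar j=\varepsilon j$, $\bar{\tilde\chi}=\varepsilon\tilde\chi$, $\bar\phi_0=\varepsilon\phi_0$, $\bar\phi_1=\varepsilon\phi_1$, $\bar{\mathcal J}=\varepsilon\mathcal J$, and the barred quantities are independent of $\varepsilon$ (so $j,\tilde\chi$ are of order $\varepsilon^{-1}$). Chapman--Enskog expansion: $f=\sum_{i\ge0}\varepsilon^i f_i$, $\beta=\sum_{i\ge0}\varepsilon^i\beta_i$,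 $\beta_i=\frac12\int_{-1}^1 f_i\,d\mu$. Enskog's postulate: $f=f\big(r,\mu,\omega\,|\,\beta,\frac{\partial\beta}{\partial r},\frac{\partial^2\beta}{\partial r^2},\dots\big)$, and likewise all $f_i$, depend on time only via $\beta$ and its spatial derivatives, which are treated as independent variables. With $\frac{\partial_i}{\partial t}:=\sum_{k=0}^\infty\frac{\partial^k}{\partial r^k}\frac{\partial\beta_i}{\partial t}\cdot\frac{\partial}{\partial\frac{\partial^k\beta}{\partial r^k}}$ one has formally $\mathcal D(f)=\sum_{i\ge0}\varepsilon^i\mathcal D(f)^{(i)}$, $$\mathcal D(f)^{(i)}=\sum_{l=0}^i\frac{\partial_{i-l}f_l}{c\,\partial t}+v\frac{\partial f_i}{c\,\partial r}+\mu\frac{\partial f_i}{\partial r}+F_\mu\frac{\partial f_i}{\partial\mu}+F_\omega\frac{\partial f_i}{\partial\omega},$$ and the $f_i$ solve the hierarchy $0=j+\mathcal J(f_0)$, $\mathcal D(f)^{(i-1)}=\bar{\mathcal J}(f_i)$, $i=1,2,\dots$. Meaning of the conclusion: the angular mean of Boltzmann's equation is $\frac12\int_{-1}^1\mathcal D(f)\,d\mu=j-\tilde\chi\beta$, and the conclusion states that its left-hand side equals the left-hand side of the reaction-type equation plus $\mathcal O(\varepsilon)$. All series are formal; series, integrals and partial derivatives are assumed to be interchangeable; $\mathcal O(\varepsilon^k)$ denotes, in the formal sense, the neglected part starting with order $\varepsilon^k$ of a formal series in $\varepsilon$. *)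

(* Defs.v *)
From Stdlib Require Import Reals.
From Coquelicot Require Import Coquelicot.

Open Scope R_scope.

(* Argument order: t r omega for [density], t r mu omega for [distribution].
   The physical domain is 0 < r, 0 < omega, -1 <= mu <= 1, with t arbitrary;
   values elsewhere are irrelevant. *)
Definition density := R -> R -> R -> R.
Definition distribution := R -> R -> R -> R -> R.

(* A formal power series in epsilon is the sequence of its coefficients. *)

Definition constant_series (b : density) : nat -> density :=
  fun i t r w => match i with O => b t r w | S _ => 0 end.

Definition eq_series (a b : nat -> density) : Prop :=
  forall i t r w, 0 < r -> 0 < w -> a i t r w = b i t r w.

(* a = b + O(epsilon^k) in the formal sense: a - b starts with order k. *)
Definition eq_series_bigO (k : nat) (a b : nat -> density) : Prop :=
  forall i t r w, (i < k)%nat -> 0 < r -> 0 < w -> a i t r w = b i t r w.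

Definition angular_mean (g : R -> R) : R := / 2 * RInt g (-1) 1.

Definition mean (f : distribution) : density :=
  fun t r w => angular_mean (fun mu => f t r mu w).

Definition collision (phi0 phi1 : density) (f : distribution) : distribution :=
  fun t r mu w =>
    - phi0 t r w * f t r mu w
    + phi0 t r w * angular_mean (fun m => f t r m w)
    + 3 * mu * phi1 t r w * angular_mean (fun m => f t r m w * m).

Definition interaction (chit phi0 phi1 : density) (f : distribution)
  : distribution :=
  fun t r mu w => - chit t r w * f t r mu w + collision phi0 phi1 f t r mu w.

(* The unbarred quantities are recovered from the epsilon-independent barred
   ones, e.g. j = jbar / epsilon. *)
Definition unbar (eps : R) (q : density) : density :=
  fun t r w => q t r w / eps.

Definition add_density (a b : density) : density := fun t r w => a t r w + b t r w.

(* d ln(rho) / (c dt), with d/dt = @_t + v @_r. *)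
Definition dlnrho (c : R) (rho v : R -> R -> R) (t r : R) : R :=
  (Derive (fun s => ln (rho s r)) t
   + v t r * Derive (fun x => ln (rho t x)) r) / c.

Definition F_mu (c : R) (rho v : R -> R -> R) (t r mu : R) : R :=
  / r * (1 - mu ^ 2)
  + mu * (dlnrho c rho v t r + 3 * v t r / (c * r)) * (1 - mu ^ 2).

Definition F_omega (c : R) (rho v : R -> R -> R) (t r mu w : R) : R :=
  (mu ^ 2 * (dlnrho c rho v t r + 3 * v t r / (c * r)) - v t r / (c * r)) * w.

(* Enskog's postulate: a coefficient f_i is a function of r, mu, omega and of
   the sequence (beta, @_r beta, @_r^2 beta, ...), with no explicit time. *)
Definition enskog := R -> R -> R -> (nat -> R) -> R.

Definition jet (b : density) (t r w : R) : nat -> R :=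
  fun k => Derive_n (fun x => b t x w) k r.

Definition along (b : density) (F : enskog) : distribution :=
  fun t r mu w => F r mu w (jet b t r w).

Definition jet_partial (k : nat) (G : (nat -> R) -> R) (p : nat -> R) : R :=
  Derive (fun x => G (fun n => if Nat.eqb n k then x else p n)) (p k).

(* Hadamard differentiability on R^nat: the chain rule
   d/ds G(q(s)) = sum_k q_k'(s) * @G/@p_k holds along every coordinatewise
   differentiable curve through p. Any G that depends on finitely many
   coordinates and is Frechet differentiable in them at p qualifies. *)
Definition jet_differentiable (G : (nat -> R) -> R) (p : nat -> R) : Prop :=
  forall (q : R -> nat -> R) (s : R),
    q s = p ->
    (forall k, ex_derive (fun x => q x k) s) ->
    ex_series (fun k => Derive (fun x => q x k) s * jet_partial k G p) /\
    is_derive (fun x => G (q x)) s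
      (Series (fun k => Derive (fun x => q x k) s * jet_partial k G p)).

(* @_r^k beta and @_r^k @_t beta exist for all k, and @_t commutes with
   @_r^k on beta. *)
Definition interchangeable_derivatives (b : density) : Prop :=
  forall k t r w, 0 < r -> 0 < w ->
    ex_derive_n (fun x => b t x w) k r /\
    ex_derive (fun s => Derive_n (fun x => b s x w) k r) t /\
    ex_derive_n (fun x => Derive (fun s => b s x w) t) k r /\
    Derive_n (fun x => Derive (fun s => b s x w) t) k r
      = Derive (fun s => Derive_n (fun x => b s x w) k r) t.

(* (@_i / @t) F evaluated along beta, where [bi] is beta_i. *)
Definition partial_time (bi b : density) (F : enskog) : distribution :=
  fun t r mu w =>
    Series (fun k => Derive_n (fun x => Derive (fun s => bi s x w) t) k r
                     * jet_partial k (F r mu w) (jet b t r w)).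

(* The coefficient D(f)^(i); its @_r and @_omega are the total partial
   derivatives of f_i(t, r, mu, omega), also acting through beta. *)
Definition D_coeff (c : R) (rho v : R -> R -> R) (b : density)
    (F : nat -> enskog) (i : nat) : distribution :=
  fun t r mu w =>
    sum_f_R0 (fun l =>
      partial_time (mean (along b (F (i - l)%nat))) b (F l) t r mu w / c) i
    + v t r * Derive (fun x => along b (F i) t x mu w) r / c
    + mu * Derive (fun x => along b (F i) t x mu w) r
    + F_mu c rho v t r mu * Derive (fun m => along b (F i) t r m w) mu
    + F_omega c rho v t r mu w * Derive (fun x => along b (F i) t r mu x) w.

(* The coefficients of epsilon^(-1) (jbar + Jbar(f)). The scalar prefactor
   1/epsilon is kept, so the coefficient of epsilon^i is j + J(f_0) for i = 0
   and J(f_i) for i > 0, with unbarred j and J. *)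
Definition boltzmann_rhs (eps : R) (jbar chitbar phi0bar phi1bar b : density)
    (F : nat -> enskog) (i : nat) : distribution :=
  fun t r mu w =>
    / eps * (constant_series jbar i t r w
             + interaction chitbar phi0bar phi1bar (along b (F i)) t r mu w).

Definition reaction_lhs (c : R) (rho v : R -> R -> R) (b : density) : density :=
  fun t r w =>
    (Derive (fun s => b s r w) t + v t r * Derive (fun x => b t x w) r) / c
    + 1 / 3 * dlnrho c rho v t r * w * Derive (fun x => b t r x) w.

Definition reaction_rhs (j chit b : density) : density :=
  fun t r w => j t r w - chit t r w * b t r w.

(* Main.v *)
(* The order-zero equation is affine in mu, so its mean and first moment force
   the first moment of f_0 to vanish and f_0 = beta, independently of mu.
   Hence D(f)^(0) is a quadratic polynomial in mu, whose mean is the left-hand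
   side of the reaction equation. Scattering conserves the mean, so the mean of
   the right-hand side depends only on the mean of f, which is beta. *)

Require Import Defs.
From Stdlib Require Import Reals Lra Lia.
From Coquelicot Require Import Coquelicot.

Open Scope R_scope.

Lemma angular_mean_ext (g h : R -> R) :
  (forall mu, -1 < mu < 1 -> g mu = h mu) -> angular_mean g = angular_mean h.
Proof.
  intros H. unfold angular_mean. f_equal. apply RInt_ext. intros mu Hmu.
  rewrite Rmin_left, Rmax_right in Hmu by lra. now apply H.
Qed.

Lemma angular_mean_quadratic (a0 a1 a2 : R) :
  angular_mean (fun mu => a0 + a1 * mu + a2 * mu ^ 2) = a0 + a2 / 3.
Proof.
  unfold angular_mean.
  pose (G := fun x : R => a0 * x + a1 * x ^ 2 / 2 + a2 * x ^ 3 / 3).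
  assert (HG : is_RInt (fun mu => a0 + a1 * mu + a2 * mu ^ 2) (-1) 1
                 (G 1 - G (-1))).
  { apply (is_RInt_derive G); intros x _.
    - unfold G. auto_derive; [easy | field].
    - apply (ex_derive_continuous
               (fun mu : R => a0 + a1 * mu + a2 * mu ^ 2)).
      auto_derive. easy. }
  rewrite (is_RInt_unique _ _ _ _ HG). unfold G. field.
Qed.

(** The linear term is odd in [mu] and integrates to zero. Only integrability of [g] is assumed, so
    that coefficients [f_i] without a closed form are covered. *)
Lemma angular_mean_affine_comb (a b d : R) (g : R -> R) :
  ex_RInt g (-1) 1 ->
  angular_mean (fun mu => a + b * mu + d * g mu) = a + d * angular_mean g.
Proof.
  intros Hg.
  assert (Hp : ex_RInt (fun mu : R => a + b * mu) (-1) 1).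
  { apply (@ex_RInt_continuous R_CompleteNormedModule). intros x _.
    apply (ex_derive_continuous (fun mu : R => a + b * mu)).
    auto_derive. easy. }
  assert (Ep : angular_mean (fun mu : R => a + b * mu) = a).
  { rewrite (angular_mean_ext _ (fun mu => a + b * mu + 0 * mu ^ 2))
      by (intros; ring).
    rewrite angular_mean_quadratic. field. }
  unfold angular_mean in *.
  pose proof (is_RInt_plus _ _ _ _ _ _ (RInt_correct _ _ _ Hp)
    (is_RInt_scal _ _ _ d _ (RInt_correct _ _ _ Hg))) as H.
  apply is_RInt_unique in H.
  (* The abstract [plus] and [scal] of the normed module become real addition and multiplication. *)
  change (RInt (fun mu => a + b * mu + d * g mu) (-1) 1
          = RInt (fun mu => a + b * mu) (-1) 1 + d * RInt g (-1) 1) in H.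
  rewrite H, Rmult_plus_distr_l, Ep. ring.
Qed.

(** With the moments [A0] and [A1] held as constants, the equation can be solved for [f] pointwise,
    since [s] is nonzero. Taking the same two moments of the solution closes the system. *)
Lemma interaction_equilibrium_isotropic (j chit phi0 phi1 : density)
    (f : distribution) (t r w : R) :
  chit t r w + phi0 t r w <> 0 ->
  chit t r w + phi0 t r w - phi1 t r w <> 0 ->
  (forall mu, -1 <= mu <= 1 ->
     0 = j t r w + interaction chit phi0 phi1 f t r mu w) ->
  forall mu, -1 <= mu <= 1 -> f t r mu w = mean f t r w.
Proof.
  intros Hs Hd Heq. unfold interaction, collision in Heq. unfold mean.
  set (A0 := angular_mean (fun m => f t r m w)) in *.
  set (A1 := angular_mean (fun m => f t r m w * m)) in *.
  set (s := chit t r w + phi0 t r w) in *.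
  assert (Hf : forall mu, -1 <= mu <= 1 ->
    f t r mu w
      = (j t r w + phi0 t r w * A0) / s + 3 * phi1 t r w * A1 / s * mu).
  { intros mu Hmu. specialize (Heq mu Hmu).
    apply Rmult_eq_reg_l with s; [| exact Hs].
    field_simplify; [| exact Hs]. unfold s. lra. }
  assert (E0 : A0 = (j t r w + phi0 t r w * A0) / s).
  { unfold A0 at 1.
    rewrite (angular_mean_ext _ (fun mu => (j t r w + phi0 t r w * A0) / s
      + 3 * phi1 t r w * A1 / s * mu + 0 * mu ^ 2))
      by (intros mu Hmu; rewrite Hf by lra; ring).
    rewrite angular_mean_quadratic. field. exact Hs. }
  (* The mean 1/3 of [mu ^ 2] cancels the factor 3 of the anisotropic scattering term. *)
  assert (E1 : A1 = phi1 t r w * A1 / s).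
  { unfold A1 at 1.
    rewrite (angular_mean_ext _ (fun mu =>
      0 + (j t r w + phi0 t r w * A0) / s * mu
      + 3 * phi1 t r w * A1 / s * mu ^ 2))
      by (intros mu Hmu; rewrite Hf by lra; ring).
    rewrite angular_mean_quadratic. field. exact Hs. }
  assert (Z1 : A1 = 0).
  { apply Rmult_eq_reg_l with (s - phi1 t r w); [| exact Hd].
    apply (f_equal (Rmult s)) in E1.
    replace (s * (phi1 t r w * A1 / s)) with (phi1 t r w * A1) in E1
      by (field; exact Hs).
    lra. }
  intros mu Hmu. rewrite Hf, <- E0, Z1 by exact Hmu. field. exact Hs.
Qed.

Lemma locally_pos (x : R) (P : R -> Prop) :
  0 < x -> (forall y, 0 < y -> P y) -> locally x P.
Proof.
  intros Hx HP. apply (filter_imp (Rlt 0)); [exact HP |].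
  now apply (open_gt 0).
Qed.

(** This is the chain rule along the curve of jets of [b] at fixed [r] and [w], with mixed
    derivatives commuted. The separate [b'] stands for the mean of [f_0], known to equal [b] only at
    positive radii; radial derivatives at [r] are local, so this suffices. *)
Lemma partial_time_self (b b' : density) (G : enskog) (t r mu w : R) :
  0 < r -> 0 < w ->
  (forall s x, 0 < x -> b' s x w = b s x w) ->
  interchangeable_derivatives b ->
  jet_differentiable (G r mu w) (jet b t r w) ->
  partial_time b' b G t r mu w = Derive (fun s => along b G s r mu w) t.
Proof.
  intros Hr Hw Hbb Hb HG.
  destruct (HG (fun s => jet b s r w) t eq_refl) as [_ HD].
  { intros k. exact (proj1 (proj2 (Hb k t r w Hr Hw))). }
  transitivity (Series (fun k => Derive (fun s => jet b s r w k) t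
                                 * jet_partial k (G r mu w) (jet b t r w))).
  2: { symmetry. exact (is_derive_unique _ _ _ HD). }
  unfold partial_time. apply Series_ext. intros k. f_equal.
  destruct (Hb k t r w Hr Hw) as (_ & _ & _ & Hcomm).
  unfold jet. rewrite <- Hcomm. apply Derive_n_ext_loc.
  apply locally_pos; [exact Hr |]. intros y Hy.
  apply Derive_ext. intros s. now apply Hbb.
Qed.

(* At mu = -1 and mu = 1 the unknown mu-derivative of f_0 is multiplied by
   F_mu = 0, but the mean does not see these points anyway. *)
Lemma mean_D_coeff_isotropic (c : R) (rho v : R -> R -> R) (b : density)
    (F : nat -> enskog) (t r w : R) :
  0 < c -> 0 < r -> 0 < w ->
  interchangeable_derivatives b ->
  (forall mu, -1 < mu < 1 -> jet_differentiable (F O r mu w) (jet b t r w)) ->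
  (forall s x mu y, 0 < x -> -1 <= mu <= 1 -> 0 < y ->
     along b (F O) s x mu y = b s x y) ->
  mean (D_coeff c rho v b F 0) t r w = reaction_lhs c rho v b t r w.
Proof.
  intros Hc Hr Hw Hb HF Hiso.
  assert (Hmean : forall s x, 0 < x ->
    mean (along b (F O)) s x w = b s x w).
  { intros s x Hx. unfold mean.
    rewrite (angular_mean_ext _ (fun mu => b s x w + 0 * mu + 0 * mu ^ 2))
      by (intros mu Hmu; rewrite Hiso by lra; ring).
    rewrite angular_mean_quadratic. field. }
  pose (bt := Derive (fun s => b s r w) t).
  pose (br := Derive (fun x => b t x w) r).
  pose (bw := Derive (fun x => b t r x) w).
  (* [K] is the bracket shared by [F_mu] and [F_omega]. In the mean, [K / 3] contributes
     [v / (c r)], which cancels the term [- v / (c r)] of [F_omega] and leaves one third of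
     [dlnrho]. *)
  pose (K := dlnrho c rho v t r + 3 * v t r / (c * r)).
  unfold mean.
  rewrite (angular_mean_ext _ (fun mu =>
    ((bt + v t r * br) / c - v t r / (c * r) * w * bw)
    + br * mu + K * w * bw * mu ^ 2)).
  - rewrite angular_mean_quadratic.
    unfold K, bt, br, bw, reaction_lhs. field. lra.
  - intros mu Hmu. unfold D_coeff, F_omega. simpl sum_f_R0.
    rewrite (partial_time_self b) by auto.
    assert (Et : Derive (fun s => along b (F O) s r mu w) t = bt).
    { apply Derive_ext. intros s. apply Hiso; lra. }
    assert (Er : Derive (fun x => along b (F O) t x mu w) r = br).
    { apply Derive_ext_loc, locally_pos; [exact Hr |].
      intros x Hx. apply Hiso; lra. }
    assert (Ew : Derive (fun x => along b (F O) t r mu x) w = bw).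
    { apply Derive_ext_loc, locally_pos; [exact Hw |].
      intros x Hx. apply Hiso; lra. }
    assert (Em : Derive (fun m => along b (F O) t r m w) mu = 0).
    { rewrite <- (Derive_const (b t r w) mu). apply Derive_ext_loc.
      apply (filter_imp (fun m => -1 < m /\ m < 1)).
      - intros m Hm. apply Hiso; lra.
      - apply filter_and; [now apply (open_gt (-1)) | now apply (open_lt 1)]. }
    rewrite Et, Er, Ew, Em. fold K. field. lra.
Qed.

(** The loss [- phi0 f] and the gain [phi0 A0] have opposite means, and the [phi1] term is a
    constant times [mu], hence odd. Only absorption and the source survive. *)
Lemma mean_boltzmann_rhs (eps : R) (jbar chitbar phi0bar phi1bar b : density)
    (F : nat -> enskog) (i : nat) (t r w : R) :
  ex_RInt (fun mu => along b (F i) t r mu w) (-1) 1 ->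
  mean (boltzmann_rhs eps jbar chitbar phi0bar phi1bar b F i) t r w
    = / eps * (constant_series jbar i t r w
               - chitbar t r w * mean (along b (F i)) t r w).
Proof.
  intros Hf. unfold mean, boltzmann_rhs, interaction, collision.
  set (f := along b (F i)) in *.
  set (A0 := angular_mean (fun m => f t r m w)).
  set (A1 := angular_mean (fun m => f t r m w * m)).
  rewrite (angular_mean_ext _ (fun mu =>
    / eps * (constant_series jbar i t r w + phi0bar t r w * A0)
    + / eps * (3 * phi1bar t r w * A1) * mu
    + - (/ eps * (chitbar t r w + phi0bar t r w)) * f t r mu w))
    by (intros; ring).
  rewrite angular_mean_affine_comb by exact Hf. fold A0. ring.
Qed.

Theorem theorem2p13
    (c : R) (rho v : R -> R -> R)
    (jbar chibar phi0bar phi1bar : density)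
    (F : nat -> enskog)
    (eps : R) (beta : density) :
  let chitbar := add_density jbar chibar in
  let j := unbar eps jbar in
  let chi := unbar eps chibar in
  let phi0 := unbar eps phi0bar in
  let phi1 := unbar eps phi1bar in
  let chit := add_density j chi in
  let f := fun i => along beta (F i) in
  let Df := D_coeff c rho v beta F in
  0 < c ->
  0 < eps ->
  (forall t r, 0 < r -> 0 < rho t r) ->
  (forall t r w, 0 < r -> 0 < w -> 0 <= j t r w /\ 0 <= chi t r w) ->
  (forall t r w, 0 < r -> 0 < w ->
     chit t r w <> 0 /\
     chit t r w + phi0 t r w <> 0 /\
     chit t r w + phi0 t r w - phi1 t r w <> 0) ->
  (* regularity *)
  interchangeable_derivatives beta ->
  (forall i t r mu w, 0 < r -> -1 <= mu <= 1 -> 0 < w ->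
     jet_differentiable (F i r mu w) (jet beta t r w)) ->
  (forall i t r w, 0 < r -> 0 < w ->
     ex_RInt (fun mu => f i t r mu w) (-1) 1 /\
     ex_RInt (fun mu => f i t r mu w * mu) (-1) 1) ->
  (* hierarchy *)
  (forall t r mu w, 0 < r -> -1 <= mu <= 1 -> 0 < w ->
     0 = j t r w + interaction chit phi0 phi1 (f 0%nat) t r mu w) ->
  (forall i t r mu w, (1 <= i)%nat -> 0 < r -> -1 <= mu <= 1 -> 0 < w ->
     Df (i - 1)%nat t r mu w
       = interaction chitbar phi0bar phi1bar (f i) t r mu w) ->
  (* strong Chapman-Enskog hypothesis *)
  (forall t r w, 0 < r -> 0 < w -> mean (f 0%nat) t r w = beta t r w) ->
  (forall i t r w, (1 <= i)%nat -> 0 < r -> 0 < w ->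
     mean (f i) t r w = 0) ->
  eq_series_bigO 1
    (fun i => mean (Df i))
    (constant_series (reaction_lhs c rho v beta)) /\
  eq_series
    (fun i => mean (boltzmann_rhs eps jbar chitbar phi0bar phi1bar beta F i))
    (constant_series (reaction_rhs j chit beta)).
Proof.
  intros chitbar j chi phi0 phi1 chit f Df Hc Heps _ _ Hne Hb HF Hint H0 _
    Hmean0 Hmean.
  (* The equilibrium equation gives [f_0] as its own mean, which the strong Chapman-Enskog
     hypothesis identifies with [beta]. *)
  assert (Hiso : forall s x mu y, 0 < x -> -1 <= mu <= 1 -> 0 < y ->
    f O s x mu y = beta s x y).
  { intros s x mu y Hx Hmu Hy. rewrite <- (Hmean0 s x y Hx Hy).
    destruct (Hne s x y Hx Hy) as (_ & Hs & Hd).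
    apply (interaction_equilibrium_isotropic j chit phi0 phi1); auto. }
  split.
  - intros i t r w Hi Hr Hw. replace i with O by lia.
    apply mean_D_coeff_isotropic; auto.
    intros mu Hmu. apply HF; lra.
  - intros i t r w Hr Hw. destruct (Hint i t r w Hr Hw) as [Hf _].
    rewrite mean_boltzmann_rhs by exact Hf. fold (f i).
    (* At order zero the prefactor [/ eps] turns barred coefficients into unbarred ones. At higher
       orders the source and the mean of [f_i] both vanish, so this side agrees at every order. *)
    destruct i as [| i]; simpl constant_series.
    + rewrite Hmean0 by assumption.
      unfold reaction_rhs, chit, chitbar, add_density, j, chi, unbar.
      field. lra.
    + rewrite Hmean by (assumption || lia). ring.
Qed.
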